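(* Let $T$ be a finite tree of order at least three whose centre consists of the two endpoints of an edge $e$ (the central edge), and suppose some automorphism of $T$ interchanges the endpoints of $e$. Let $(T',r)$ be either component of $T-e$, rooted at the endpoint $r$ of $e$ that it contains (the two rooted components are isomorphic). (i) If $(T',r)$ admits at least two non-isomorphic optimal distinguishing colourings, then $$OD'^+(T)=D'(T),\qquad OD'^-(T)=\left\lceil\frac{D'(T)}{2}\right\rceil.$$ (ii) If $(T',r)$ has a unique optimal distinguishing colouring up to a root-preserving automorphism, then $$OD'^+(T)=D'(T)-1,\qquad OD'^-(T)=\left\lceil\frac{D'(T)-1}{2}\right\rceil.$$
   Context: Write $[k]=\{1,\ldots,k\}$. For a graph $G$, an edge colouring $c\colon E(G)\to[k]$ (not necessarily proper) breaks an automorphism $\varphi\in\operatorname{Aut}(G)$ if some edge $xy$ satisfies $c(\varphi(x)\varphi(y))\neq c(xy)$; it is distinguishing if it breaks every non-trivial automorphism of $G$. The distinguishing index $D'(G)$ is the least integer $k\ge 1$ for which $G$ has a distinguishing colouring $E(G)\to[k]$. For a digraph, automorphisms preserve arcs together with their directions, and distinguishing arc colourings and the distinguishing index $D'$ are defined in the same way with arcs in place of edges. An orientation of $G$ is a digraph $\overrightarrow{G}$ obtained from $G$ by replacing each edge $xy$ with exactly one of the arcs $\overrightarrow{xy}$, $\overrightarrow{yx}$. Define $OD'^-(G)=\min D'(\overrightarrow{G})$ and $OD'^+(G)=\max D'(\overrightarrow{G})$, both over all orientations $\overrightarrow{G}$ of $G$. The centre of a tree (the set of vertices of minimum eccentricity)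 consists of a single vertex or of the two endpoints of an edge. An automorphism of a rooted tree $(T',r)$ is an automorphism of $T'$ fixing $r$ (a root-preserving automorphism). The distinguishing index $D'((T',r))$ is the least integer $q\geq 1$ such that some edge colouring $E(T')\to[q]$ breaks all non-trivial root-preserving automorphisms; a colouring $E(T')\to[q]$ with $q=D'((T',r))$ that breaks all non-trivial root-preserving automorphisms is an optimal distinguishing colouring. Colourings are compared using the same fixed palette $[q]$: two edge colourings $c_1,c_2$ of $(T',r)$ are isomorphic if there is a root-preserving automorphism $\varphi$ with $c_2(xy)=c_1(\varphi(x)\varphi(y))$ for every $xy\in E(T')$, and non-isomorphic otherwise. Colours themselves may not be permuted. *)

(* Defs.v *)
From mathcomp Require Import all_boot all_fingroup.

Set Implicit Arguments.
Unset Strict Implicit.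
Unset Printing Implicit Defensive.

(* A graph or a digraph with vertex set V is given by its adjacency relation;
   a simple graph is a symmetric irreflexive one. *)

Section Trees.
Variable V : finType.
Implicit Types (e : rel V) (x y u v : V).

Definition simple_graph e : Prop := symmetric e /\ irreflexive e.

(* For a simple graph, [ucycle e s] with [size s = 2] only says that s runs
   through one edge back and forth, hence the bound 2. *)
Definition acyclic e : Prop := forall s : seq V, ucycle e s -> size s <= 2.

Definition tree e : Prop :=
  [/\ simple_graph e, 0 < #|V|, (forall x y, connect e x y) & acyclic e].

Definition has_walk e x y (n : nat) : bool :=
  [exists p : n.-tuple V, path e x p && (last x p == y)].

(* The least length of a walk from x to y. A vertex reachable from x is
   reached by a walk of length < #|V|; the value is #|V| if there is none. *)
Definition dist e x y : nat := find (has_walk e x y) (iota 0 #|V|).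

Definition eccentricity e x : nat := \max_(y : V) dist e x y.

Definition centre e : {set V} :=
  [set x | [forall y, eccentricity e x <= eccentricity e y]].

Definition del_edge e u v : rel V :=
  fun x y => e x y && ([set x; y] != [set u; v]).

Definition component e r : finType := {x : V | connect e r x}.

Definition component_rel e r : rel (component e r) :=
  fun p q => e (sval p) (sval q).

Definition component_root e r : component e r := exist _ r (connect0 e r).

End Trees.

Arguments component_rel {V} e r.

Section Distinguishing.
Variable V : finType.
Implicit Types (e a : rel V) (r x y : V) (phi : {perm V}).

(* Serves both graphs and digraphs. *)
Definition automorphism e phi : Prop := {mono phi : x y / e x y}.

(* Colourings are total functions, with palette 'I_k in place of {1, .., k}: an
   edge colouring assigns a colour to every set of vertices, but only its values
   on the sets [set x; y] with e x y are ever used; likewise for arcs. *)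
Definition edge_colouring (k : nat) := {set V} -> 'I_k.
Definition arc_colouring (k : nat) := V -> V -> 'I_k.

Definition breaks k e (c : edge_colouring k) phi : Prop :=
  exists x y, e x y /\ c [set phi x; phi y] != c [set x; y].

Definition distinguishing k e (c : edge_colouring k) : Prop :=
  forall phi, automorphism e phi -> phi != 1%g -> breaks e c phi.

Definition arc_breaks k a (c : arc_colouring k) phi : Prop :=
  exists x y, a x y /\ c (phi x) (phi y) != c x y.

Definition arc_distinguishing k a (c : arc_colouring k) : Prop :=
  forall phi, automorphism a phi -> phi != 1%g -> arc_breaks a c phi.

Definition rooted_automorphism e r phi : Prop :=
  automorphism e phi /\ phi r = r.

Definition rooted_distinguishing k e r (c : edge_colouring k) : Prop :=
  forall phi, rooted_automorphism e r phi -> phi != 1%g -> breaks e c phi.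

Definition is_least (P : nat -> Prop) (k : nat) : Prop :=
  P k /\ forall j, P j -> k <= j.

(* Some graphs (such as the one with two vertices and one edge) have no
   distinguishing colouring, so the indices are relations: [dist_index e k]
   says that the index is defined and equal to k. *)
Definition dist_index e : nat -> Prop :=
  is_least (fun k => 0 < k /\ exists c : edge_colouring k, distinguishing e c).

Definition arc_dist_index a : nat -> Prop :=
  is_least (fun k => 0 < k /\ exists c : arc_colouring k, arc_distinguishing a c).

Definition rooted_dist_index e r : nat -> Prop :=
  is_least (fun k =>
    0 < k /\ exists c : edge_colouring k, rooted_distinguishing e r c).

Definition orientation e a : Prop :=
  (forall x y, a x y -> e x y) /\ (forall x y, e x y -> a x y (+) a y x).

(* OD'^-(G) = d and OD'^+(G) = d: the index is defined for every orientation,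
   and d is the least, respectively the greatest, of its values. *)
Definition OD_min e (d : nat) : Prop :=
  (exists2 a, orientation e a & arc_dist_index a d) /\
  (forall a, orientation e a -> exists2 k, arc_dist_index a k & d <= k).

Definition OD_max e (d : nat) : Prop :=
  (exists2 a, orientation e a & arc_dist_index a d) /\
  (forall a, orientation e a -> exists2 k, arc_dist_index a k & k <= d).

Definition optimal_colouring q e r (c : edge_colouring q) : Prop :=
  rooted_dist_index e r q /\ rooted_distinguishing e r c.

Definition isomorphic_colourings q e r (c1 c2 : edge_colouring q) : Prop :=
  exists2 phi, rooted_automorphism e r phi &
    forall x y, e x y -> c2 [set x; y] = c1 [set phi x; phi y].

Definition two_optimal_colourings e r : Prop :=
  exists q (c1 c2 : edge_colouring q),
    [/\ optimal_colouring e r c1, optimal_colouring e r c2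
      & ~ isomorphic_colourings e r c1 c2].

Definition unique_optimal_colouring e r : Prop :=
  exists q (c : edge_colouring q), optimal_colouring e r c /\
    forall c' : edge_colouring q,
      optimal_colouring e r c' -> isomorphic_colourings e r c c'.

End Distinguishing.

(* Main.v *)
Require Import Defs.
From mathcomp Require Import all_boot all_fingroup.
From Stdlib Require Import Classical.

Set Implicit Arguments.
Unset Strict Implicit.
Unset Printing Implicit Defensive.

(** Deleting the central edge uv leaves two branches, and an automorphism s
    swapping u and v identifies the branch at v with the branch (T', r) at u.
    Let q be the distinguishing index of (T', r).

    Every automorphism of T preserves the centre, so it either fixes both u and
    v, and is then a pair of root-preserving automorphisms of the branches, or
    swaps them. Hence an edge colouring of T is distinguishing exactly when the
    two colourings of T' that it induces are distinguishing and not isomorphic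
    ([distinguishing_halves]). So D'(T) = q if two non-isomorphic optimal
    colourings of T' exist. Otherwise D'(T) = q + 1: with one more colour, an
    optimal colouring can be relabelled so as to miss the new colour, or so as
    to miss a colour other than the new one, and these two are not isomorphic
    ([extra_colour]).

    An automorphism of an orientation of T cannot reverse the arc on uv, so it
    fixes u and v, and an arc colouring is distinguishing exactly when it
    distinguishes each branch ([arc_distinguishing_halves]). Both extreme values
    of the index then depend on q alone, and are q and q/2 rounded up, in either
    case of the theorem:
    - Every orientation is distinguished by q colours. The orientation away
      from u carries no information that a root-preserving automorphism could
      violate, so it needs q of them ([OD_max_rooted]).
    - A direction together with one of k colours amounts to one of 2k colours,
      so q <= 2k for every orientation. Conversely, an optimal colouring of T'
      can be spelled as the parity (the direction) and the half (the colour) of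
      its values ([OD_min_rooted]).

    In order not to move back and forth between T' and T, the colourings of T'
    are replaced by functions f on pairs of vertices of T, and the condition
    that f distinguishes T' by [rigid f], which only speaks of automorphisms of
    T. Isomorphism of colourings of T' is treated likewise. *)

(** * Preliminaries *)

(** The contrapositive form of the definitions of distinguishing colourings,
    shared by edge colourings, rooted edge colourings and arc colourings. *)
Lemma detectingP (V : finType) (K : eqType) (P : {perm V} -> Prop) (R : rel V)
    (h : V -> V -> K) :
  (forall phi, P phi -> phi != 1%g ->
     exists x y, R x y /\ h (phi x) (phi y) != h x y) <->
  (forall phi, P phi -> (forall x y, R x y -> h (phi x) (phi y) = h x y) ->
     phi = 1%g).
Proof.
split=> H phi Pphi => [keep|phi1].
  apply/eqP/negPn/negP => phi1; have [x [y [Rxy]]] := H _ Pphi phi1.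
  by rewrite keep ?eqxx.
case: (boolP [exists x, exists y, R x y && (h (phi x) (phi y) != h x y)]).
  by case/existsP=> x /existsP[y /andP[Rxy hxy]]; exists x, y.
move=> none; case/eqP: phi1; apply: H Pphi _ => x y Rxy; apply/eqP.
apply: contraNT none => hxy; apply/existsP; exists x; apply/existsP; exists y.
by rewrite Rxy.
Qed.

(** Classical, since the existence of a distinguishing colouring is stated over
    a function space. *)
Lemma ex_least (P : nat -> Prop) n : P n -> exists k, is_least P k.
Proof.
elim/ltn_ind: n => n IHn Pn.
have [[m [Pm lt_mn]]|none] := classic (exists m, P m /\ m < n).
  exact: IHn lt_mn Pm.
exists n; split=> // j Pj; rewrite leqNgt; apply/negP => lt_jn.
by apply: none; exists j.
Qed.

Lemma is_least_uniq (P : nat -> Prop) j k :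
  is_least P j -> is_least P k -> j = k.
Proof.
by move=> [Pj minj] [Pk mink]; apply/eqP; rewrite eqn_leq minj // mink.
Qed.

Lemma set2_inj (V : finType) (x y z w : V) : [set x; y] = [set z; w] ->
  (x = z /\ y = w) \/ (x = w /\ y = z).
Proof.
move=> E; have : x \in [set z; w] by rewrite -E set21.
have : y \in [set z; w] by rewrite -E set22.
have : z \in [set x; y] by rewrite E set21.
have : w \in [set x; y] by rewrite E set22.
rewrite !inE => /orP[]/eqP wE /orP[]/eqP zE /orP[]/eqP yE /orP[]/eqP xE;
  by [left; split; congruence | right; split; congruence].
Qed.

(** * Automorphisms and the two sides of an edge of a tree *)

Lemma connect_homo (V : finType) (e e' : rel V) (f : V -> V) :
  (forall x y, e x y -> e' (f x) (f y)) ->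
  forall x y, connect e x y -> connect e' (f x) (f y).
Proof.
move=> homo x y /connectP[p ep ->] {y}; elim: p x ep => [|y p IHp] x //=.
by case/andP=> exy ep; apply: connect_trans (IHp _ ep); apply/connect1/homo.
Qed.

Section Automorphisms.
Variables (V : finType) (e : rel V).
Implicit Types (psi : {perm V}) (x y : V).

Lemma automorphismM psi rho :
  automorphism e psi -> automorphism e rho -> automorphism e (psi * rho)%g.
Proof. by move=> ap ar x y; rewrite !permM ar ap. Qed.

Lemma automorphismV psi : automorphism e psi -> automorphism e psi^-1%g.
Proof. by move=> ap x y; rewrite -ap !permKV. Qed.

Lemma automorphismJ psi rho :
  automorphism e psi -> automorphism e rho -> automorphism e (psi ^ rho)%g.
Proof.
by move=> ap ar; do 2?apply: automorphismM => //; apply: automorphismV.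
Qed.

Lemma has_walk_aut psi : automorphism e psi ->
  forall x y n, has_walk e (psi x) (psi y) n = has_walk e x y n.
Proof.
move=> apsi x y n; suff imp (rho : {perm V}) z w : automorphism e rho ->
    has_walk e z w n -> has_walk e (rho z) (rho w) n.
  apply/idP/idP; last exact: imp.
  by move/(imp _ _ _ (automorphismV apsi)); rewrite !permK.
move=> arho /existsP[p /andP[ep /eqP lp]].
apply/existsP; exists (map_tuple rho p).
rewrite /= last_map lp eqxx andbT path_map.
by rewrite (eq_path (e' := e)) // => a b /=; apply: arho.
Qed.

Lemma centre_aut psi x : automorphism e psi -> x \in centre e ->
  psi x \in centre e.
Proof.
move=> apsi; have ecc z : eccentricity e (psi z) = eccentricity e z.
  rewrite /eccentricity (reindex_inj (@perm_inj _ psi)).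
  apply: eq_bigr => w _; apply: eq_find => n; exact: has_walk_aut.
by rewrite !inE => /forallP min_x; apply/forallP => y; rewrite ecc.
Qed.

Definition side x y : {set V} := [set z | connect (del_edge e x y) x z].

Lemma del_edge_aut psi x y z w : automorphism e psi ->
  del_edge e (psi x) (psi y) (psi z) (psi w) = del_edge e x y z w.
Proof.
move=> apsi; rewrite /del_edge apsi; congr (_ && ~~ _).
by rewrite -!imset_set1 -!imsetU (inj_eq (imset_inj (@perm_inj _ psi))).
Qed.

Lemma mem_side_aut psi x y z : automorphism e psi ->
  (psi z \in side (psi x) (psi y)) = (z \in side x y).
Proof.
move=> apsi; rewrite !inE; apply/idP/idP; last first.
  by apply: connect_homo => a b; rewrite del_edge_aut.
move/(connect_homo (f := psi^-1%g)); rewrite !permK; apply=> a b.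
by rewrite -[X in _ -> is_true X](del_edge_aut _ _ _ _ apsi) !permKV.
Qed.

Lemma side_root x y : x \in side x y.
Proof. by rewrite inE connect0. Qed.

Lemma del_edgeC x y : del_edge e x y =2 del_edge e y x.
Proof. by move=> z w; rewrite /del_edge [[set y; x]]setUC. Qed.

Hypothesis Ttree : tree e.

Let symE x y : e x y = e y x.
Proof. by case: Ttree => -[]. Qed.

Lemma del_edge_sym x y : symmetric (del_edge e x y).
Proof. by move=> z w; rewrite /del_edge symE setUC. Qed.

(** A path from x to y that avoids the edge xy would close up, with that edge,
    to a cycle of length at least three. *)
Lemma bridge x y : e x y -> y \notin side x y.
Proof.
move=> exy; rewrite inE; apply/negP => /connectP[p0 ep0].
case/shortenP: ep0 => p ep up _ ly.
have ep' : path e x p by apply: sub_path ep => a b /andP[].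
have : ucycle e (x :: p).
  by rewrite /ucycle up andbT /= rcons_path ep' -ly symE.
case: Ttree => -[_ irr] _ _ acyc /acyc.
case: p ep ly {up ep'} => [|z [|]] //=.
  by move=> _ yx; rewrite yx irr in exy.
by rewrite /del_edge => exz yz; rewrite yz eqxx andbF in exz.
Qed.

(** The two sides of xy are disjoint by [bridge], and their union is closed
    under adjacency, so it is everything by connectedness. *)
Lemma sideC x y : e x y -> side y x = ~: side x y.
Proof.
move=> exy; have sC a b : connect_sym (del_edge e a b).
  by apply: sym_connect_sym; apply: del_edge_sym.
have swap z : (z \in side y x) = connect (del_edge e x y) y z.
  by rewrite inE; apply: eq_connect => a b; apply: del_edgeC.
apply/setP => z; rewrite [RHS]inE swap; apply/idP/idP => [yz|].
  apply: contra (bridge exy); rewrite !inE => xz.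
  by apply: connect_trans xz _; rewrite sC.
apply: contraR => nyz.
have closedP : closed e [predU (connect (del_edge e x y) x)
                          & (connect (del_edge e x y) y)].
  apply: intro_closed => [|a b eab]; first exact: sym_connect_sym.
  rewrite !inE; case: (eqVneq [set a; b] [set x; y]) => [/set2_inj|] ab.
    by case: ab => -[_ ->] _; rewrite connect0 ?orbT.
  by case/orP=> ca; apply/orP; [left|right]; apply: connect_trans ca _;
     apply: connect1; rewrite /del_edge eab ab.
case: Ttree => _ _ conn _; have := closed_connect closedP (conn x z).
by rewrite !inE connect0 (negPf nyz) orbF => <-.
Qed.

Lemma cross_edge x y p q : e x y -> p \in side x y -> q \notin side x y ->
  e p q = (p == x) && (q == y).
Proof.
move=> exy px qx; apply/idP/idP => [epq|/andP[/eqP-> /eqP->] //].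
case: (eqVneq [set p; q] [set x; y]) => [/set2_inj[[-> ->]|[pE _]]|npq].
- by rewrite !eqxx.
- by rewrite pE (negPf (bridge exy)) in px.
case/negP: qx; rewrite !inE in px *; apply: connect_trans px (connect1 _).
by rewrite /del_edge epq.
Qed.

(** Automorphisms can be assembled from one map on each side of an edge uv: the
    only edge between the sides is uv, so it suffices that it goes to an edge xy
    and that the sides of uv go to the sides of xy. Each map
    is constrained on its own side alone, so that it may come from an
    automorphism of a single component. *)
Lemma glue_aut u v x y (f g : V -> V) : e u v -> e x y ->
    f u = x -> g v = y ->
    {in side u v, forall z, f z \in side x y} ->
    {in ~: side u v, forall z, g z \notin side x y} ->
    {in side u v &, forall z w, f z = f w -> z = w} ->
    {in ~: side u v &, forall z w, g z = g w -> z = w} ->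
    {in side u v &, forall z w, e (f z) (f w) = e z w} ->
    {in ~: side u v &, forall z w, e (g z) (g w) = e z w} ->
  exists psi : {perm V}, [/\ automorphism e psi,
    {in side u v, psi =1 f} & {in ~: side u v, psi =1 g}].
Proof.
move=> euv exy fu gv fS gS finj ginj fe ge; have uS := side_root u v.
have vS : v \in ~: side u v by rewrite in_setC bridge.
pose h z := if z \in side u v then f z else g z.
have hinj : injective h.
  move=> z w; rewrite /h; case: ifPn => zS; case: ifPn => wS E.
  - exact: finj.
  - by have := gS w; rewrite in_setC -E fS // => /(_ wS).
  - by have := gS z; rewrite in_setC E fS // => /(_ zS).
  - by apply: ginj; rewrite ?in_setC.
have across z w : z \in side u v -> w \notin side u v -> e (f z) (g w) = e z w.
  move=> zS wS; rewrite (cross_edge euv zS wS).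
  rewrite (cross_edge exy) ?fS ?gS ?in_setC //.
  rewrite -fu -gv; congr (_ && _); apply/eqP/eqP => [|-> //].
    exact: finj.
  by apply: ginj; rewrite ?vS ?in_setC.
exists (perm hinj); split=> z.
- move=> w; rewrite !permE /h; case: ifPn => zS; case: ifPn => wS.
  + exact: fe.
  + exact: across.
  + by rewrite symE across // symE.
  + by apply: ge; rewrite in_setC.
- by rewrite permE /h => ->.
- by rewrite in_setC permE /h => /negPf->.
Qed.

(** The orientation of a tree away from u. It is phrased through sides rather
    than distances, so that [sideC] shows at once that each edge gets exactly
    one direction. *)
Definition away u : rel V := fun x y => e x y && (u \in side x y).

Lemma away_orients u x y : e x y -> away u x y (+) away u y x.
Proof.
by move=> exy; rewrite /away (symE y x) exy (sideC exy) in_setC; case: (u \in _).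
Qed.

Lemma away_aut u psi x y : automorphism e psi -> psi u = u ->
  away u (psi x) (psi y) = away u x y.
Proof.
by move=> apsi psiu; rewrite /away apsi -{1}psiu mem_side_aut.
Qed.

End Automorphisms.

(** * Automorphisms of a bicentral tree *)

Section Bicentral.
Variables (V : finType) (e : rel V) (u v : V) (s : {perm V}).
Hypotheses (Ttree : tree e) (uv_edge : e u v).
Hypothesis uv_centre : centre e = [set u; v].
Hypotheses (s_aut : automorphism e s) (s_u : s u = v) (s_v : s v = u).
Implicit Types (psi : {perm V}) (x y z : V).

Notation C := (side e u v).
Notation branch := (component (del_edge e u v) u).
Notation branch_rel := (component_rel (del_edge e u v) u).
Notation branch_root := (component_root (del_edge e u v) u).

Let symE x y : e x y = e y x.
Proof. by case: Ttree => -[]. Qed.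

Let u_in : u \in C := side_root e u v.
Let v_out : v \notin C := bridge Ttree uv_edge.
Let neq_uv : u != v.
Proof. by apply: contraNneq v_out => <-; apply: side_root. Qed.

Lemma aut_ends psi : automorphism e psi ->
  (psi u = u /\ psi v = v) \/ (psi u = v /\ psi v = u).
Proof.
move=> apsi; have img z : z \in [set u; v] -> psi z \in [set u; v].
  by rewrite -uv_centre; apply: centre_aut.
have psi_uv : psi u != psi v by rewrite (inj_eq perm_inj).
have := img u (set21 u v); have := img v (set22 u v); rewrite !inE.
by move=> /orP[]/eqP pv /orP[]/eqP pu; rewrite pu pv ?eqxx in psi_uv *; auto.
Qed.

Lemma aut_fix_v psi : automorphism e psi -> psi u = u -> psi v = v.
Proof.
by move=> /aut_ends[[_ ->]//|[-> _ vu]]; case/eqP: neq_uv.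
Qed.

Lemma mem_fix psi z : automorphism e psi -> psi u = u ->
  (psi z \in C) = (z \in C).
Proof.
move=> apsi pu; have := mem_side_aut u v z apsi.
by rewrite pu (aut_fix_v apsi pu).
Qed.

Lemma mem_swap psi z : automorphism e psi -> psi u = v ->
  (psi z \in C) = (z \notin C).
Proof.
move=> apsi pu; have pv : psi v = u.
  by case: (aut_ends apsi) => -[puE //]; case/eqP: neq_uv; rewrite -puE.
rewrite -[in RHS](mem_side_aut u v z apsi) pu pv (sideC Ttree uv_edge).
by rewrite in_setC negbK.
Qed.

Definition branch_edge x y := [&& x \in C, y \in C & e x y].

Lemma branch_edge_fix psi x y : automorphism e psi -> psi u = u ->
  branch_edge (psi x) (psi y) = branch_edge x y.
Proof. by move=> apsi pu; rewrite /branch_edge !mem_fix // apsi. Qed.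

Lemma edge_cases (P : V -> V -> Prop) :
  (forall x y, P x y -> P y x) -> P u v ->
  (forall x y, branch_edge x y -> P x y) ->
  (forall x y, x \notin C -> y \notin C -> e x y -> P x y) ->
  forall x y, e x y -> P x y.
Proof.
move=> Psym Puv Pin Pout x y exy.
have across p q : p \in C -> q \notin C -> e p q -> P p q.
  by move=> pC qC; rewrite (cross_edge Ttree uv_edge pC qC) => /andP[/eqP-> /eqP->].
case xC: (x \in C); case yC: (y \in C).
- by apply: Pin; rewrite /branch_edge xC yC.
- by apply: across; rewrite ?xC ?yC.
- by apply/Psym/across; rewrite ?xC ?yC // symE.
- by apply: Pout; rewrite ?xC ?yC.
Qed.

(** The branch at u is distinguished by f, said with automorphisms of the whole
    tree: they restrict to root-preserving automorphisms of that branch, and each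
    of the latter extends by the identity on the branch at v. *)
Definition rigid T (f : V -> V -> T) :=
  forall psi, automorphism e psi -> psi u = u ->
    (forall x y, branch_edge x y -> f (psi x) (psi y) = f x y) ->
  {in C, psi =1 id}.

Definition isomorphic T (f g : V -> V -> T) :=
  exists psi, [/\ automorphism e psi, psi u = u
    & forall x y, branch_edge x y -> g x y = f (psi x) (psi y)].

(** What f does on the branch at v, read on the branch at u. *)
Definition through_s T (f : V -> V -> T) x y := f (s x) (s y).

Lemma rigid_sub T1 T2 (f : V -> V -> T1) (g : V -> V -> T2) :
  (forall psi, automorphism e psi -> psi u = u ->
     (forall x y, branch_edge x y -> g (psi x) (psi y) = g x y) ->
     (forall x y, branch_edge x y -> f (psi x) (psi y) = f x y)) ->
  rigid f -> rigid g.
Proof. by move=> sub rf psi apsi pu gpsi; apply: rf => //; apply: sub. Qed.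

Lemma eq_rigid T (f g : V -> V -> T) :
  (forall x y, branch_edge x y -> f x y = g x y) -> rigid f -> rigid g.
Proof.
move=> fg; apply: rigid_sub => psi apsi pu gpsi x y bxy.
by rewrite !fg ?branch_edge_fix // gpsi.
Qed.

Lemma eq_isomorphic T (f g f' g' : V -> V -> T) :
  (forall x y, branch_edge x y -> f x y = f' x y) ->
  (forall x y, branch_edge x y -> g x y = g' x y) ->
  isomorphic f g -> isomorphic f' g'.
Proof.
move=> ff gg [psi [apsi pu fg]]; exists psi; split=> // x y bxy.
by rewrite -gg // -ff ?fg // branch_edge_fix.
Qed.

Lemma isomorphic_sym T (f g : V -> V -> T) : isomorphic f g -> isomorphic g f.
Proof.
move=> [psi [apsi pu fg]]; have apV := automorphismV apsi.
have puV : psi^-1%g u = u by rewrite -{1}pu permK.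
exists psi^-1%g; split=> // x y bxy.
by rewrite fg ?branch_edge_fix // !permKV.
Qed.

Lemma isomorphic_trans T (f g h : V -> V -> T) :
  isomorphic f g -> isomorphic g h -> isomorphic f h.
Proof.
move=> [psi [apsi pu fg]] [rho [arho ru gh]].
exists (rho * psi)%g; split; first exact: automorphismM.
  by rewrite permM ru.
by move=> x y bxy; rewrite gh // !permM fg ?branch_edge_fix.
Qed.

Lemma extend_by_id psi : automorphism e psi -> psi u = u ->
  exists psi' : {perm V}, [/\ automorphism e psi', psi' u = u,
    {in C, psi' =1 psi} & {in ~: C, psi' =1 id}].
Proof.
move=> apsi pu.
have [||||||psi' [a' eC eC']] :=
    glue_aut (f := psi) (g := id) Ttree uv_edge uv_edge pu (erefl v).
- by move=> z zC; rewrite mem_fix.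
- by move=> z; rewrite in_setC.
- by move=> z w _ _; apply: perm_inj.
- by [].
- by move=> z w _ _; apply: apsi.
- by [].
by exists psi'; split=> //; rewrite eC.
Qed.

(** For automorphisms fixing u, the two branches are independent: one that acts
    on a single branch extends by the identity, and conjugation by s exchanges
    the roles of the branches. *)
Lemma rigid_halvesP T (f : V -> V -> T) :
  (forall psi, automorphism e psi -> psi u = u ->
     (forall x y, e x y -> f (psi x) (psi y) = f x y) -> psi = 1%g) <->
  rigid f /\ rigid (through_s f).
Proof.
split=> [whole|[rf rfs] psi apsi pu fpsi].
  (* An automorphism that acts on the branch at u alone keeps g everywhere. *)
  have local (g : V -> V -> T) psi : automorphism e psi -> psi u = u ->
      (forall x y, branch_edge x y -> g (psi x) (psi y) = g x y) ->
    exists psi' : {perm V}, [/\ automorphism e psi', psi' u = u,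
      {in C, psi' =1 psi} & forall x y, e x y -> g (psi' x) (psi' y) = g x y].
    move=> apsi pu gpsi; have [psi' [a' u' eC eC']] := extend_by_id apsi pu.
    have v' := aut_fix_v a' u'.
    have keep x y : e x y ->
        g (psi' x) (psi' y) = g x y /\ g (psi' y) (psi' x) = g y x.
      move: x y; apply: edge_cases => [x y []||x y|x y xC yC _] //.
      - by rewrite u' v'.
      - move=> bxy; have /and3P[xC yC exy] := bxy.
        by rewrite !eC // !gpsi // /branch_edge xC yC symE.
      - by rewrite !eC' ?in_setC.
    by exists psi'; split=> // x y /keep[].
  split=> psi apsi pu /local-/(_ apsi pu) [psi' [a' u' eC fpsi]] x xC.
    by rewrite -eC // (whole psi') // perm1.
  (* The conjugate by s acts on the branch at v as psi' does on that at u. *)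
  rewrite -eC //; suff: (psi' ^ s)%g = 1%g.
    by move/eqP; rewrite conjg_eq1 => /eqP->; rewrite perm1.
  apply: whole.
  - exact: automorphismJ.
  - by rewrite -{1}s_v permJ (aut_fix_v a' u').
  - move=> z w; rewrite -[z](permKV s) -[w](permKV s) s_aut !permJ => /fpsi.
    by rewrite /through_s.
have pv := aut_fix_v apsi pu.
have id_C : {in C, psi =1 id} by apply: rf => // x y /and3P[_ _]; apply: fpsi.
have aJ : automorphism e (psi ^ s^-1)%g.
  by apply: automorphismJ => //; apply: automorphismV.
have Js x : s ((psi ^ s^-1)%g x) = psi (s x).
  by rewrite conjgE invgK !permM permKV.
have Ju : (psi ^ s^-1)%g u = u.
  by apply: (@perm_inj _ s); rewrite Js s_u pv.
have id_C' : {in C, (psi ^ s^-1)%g =1 id}.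
  apply: rfs => // x y /and3P[_ _ exy]; rewrite /through_s !Js fpsi //.
  by rewrite s_aut.
apply/permP => x; rewrite perm1; case: (boolP (x \in C)) => xC.
  exact: id_C.
rewrite -[x](permKV s) -Js id_C' // -(negbK (_ \in C)) -(mem_swap _ s_aut s_u).
by rewrite permKV.
Qed.

(** Automorphisms fixing u are handled by [rigid_halvesP]. One that swaps u and
    v and keeps c gives, composed with s, an isomorphism between the colourings
    of the two branches; conversely such an isomorphism glues with its inverse
    to a colour-preserving swap. *)
Lemma distinguishing_halves k (c : edge_colouring V k) :
  let f x y := c [set x; y] in
  distinguishing e c <->
  [/\ rigid f, rigid (through_s f) & ~ isomorphic f (through_s f)].
Proof.
move=> f; have := detectingP (automorphism e) e f => detP; split.
  move/detP=> dist; have [|rf rfs] := (rigid_halvesP f).1.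
    by move=> psi apsi _; apply: dist.
  split=> // -[psi [apsi pu fpsi]].
  have apV := automorphismV apsi; have asV := automorphismV s_aut.
  have puV : psi^-1%g u = u by rewrite -{1}pu permK.
  have svV : s^-1%g v = u by rewrite -s_u permK.
  have suV : s^-1%g u = v by rewrite -s_v permK.
  have vu_edge : e v u by rewrite symE.
  have [||||||||theta [at' tC tC']] := glue_aut
      (f := (psi^-1 * s)%g) (g := (s^-1 * psi)%g) (x := v) (y := u)
      Ttree uv_edge vu_edge.
  - by rewrite permM puV.
  - by rewrite permM svV.
  - by move=> z zC; rewrite permM (sideC Ttree uv_edge) in_setC mem_swap // negbK mem_fix.
  - move=> z; rewrite permM (sideC Ttree uv_edge) !in_setC negbK mem_fix // => zC.
    by rewrite mem_swap.
  - by move=> z w _ _; apply: perm_inj.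
  - by move=> z w _ _; apply: perm_inj.
  - by move=> z w _ _; rewrite !permM s_aut apV.
  - by move=> z w _ _; rewrite !permM apsi asV.
  have tu : theta u = v by rewrite tC // permM puV.
  have tv : theta v = u by rewrite tC' ?in_setC // permM svV.
  have: theta = 1%g.
    apply: (dist _ at'); apply: edge_cases => [x y|||].
    - by rewrite /f [[set theta y; _]]setUC [[set y; _]]setUC.
    - by rewrite tu tv /f setUC.
    - move=> x y bxy; have /and3P[xC yC exy] := bxy.
      rewrite !tC // !permM -[f (s _) _]/(through_s f _ _) fpsi ?branch_edge_fix //.
      by rewrite !permKV.
    - move=> x y xC yC exy; rewrite !tC' ?in_setC // !permM -fpsi.
        by rewrite /through_s !permKV.
      by rewrite /branch_edge asV exy !(mem_swap _ asV suV) xC yC.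
  by move=> t1; rewrite t1 perm1 in tu; case/eqP: neq_uv.
move=> [rf rfs niso]; apply/detP => psi apsi fpsi.
have [[pu _]|[pu pv]] := aut_ends apsi.
  by apply: (rigid_halvesP f).2.
case: niso; exists (s * psi)%g; split; first exact: automorphismM.
  by rewrite permM s_u.
by move=> x y /and3P[_ _ exy]; rewrite !permM fpsi ?s_aut.
Qed.

(** Direction and colour of the arc on the edge xy. Recorded on both orders of
    the endpoints, it turns an arc colouring into data about edges of e, so that
    [rigid] applies. *)
Definition arc_view k (a : rel V) (c : arc_colouring V k) x y :=
  (a x y, if a x y then c x y else c y x).

(** In contrast with edge colourings, the two branches may be coloured alike: an
    automorphism that swaps u and v would reverse the arc on uv. *)
Lemma arc_distinguishing_halves k a (c : arc_colouring V k) :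
  orientation e a ->
  arc_distinguishing a c <->
  rigid (arc_view a c) /\ rigid (through_s (arc_view a c)).
Proof.
move=> [sub_ae a_or]; rewrite -rigid_halvesP.
have aE x y : e x y = a x y || a y x.
  apply/idP/orP => [/a_or|[/sub_ae //|/sub_ae]]; last by rewrite symE.
  by case: (a x y); [left|right].
have detP := detectingP (automorphism a) a c.
split=> [/detP dist psi apsi pu keep|whole].
  have pa : automorphism a psi.
    move=> x y; case exy: (e x y); first by case: (keep _ _ exy).
    by apply/idP/idP => /sub_ae; rewrite ?apsi exy.
  apply: (dist psi pa) => x y axy; case: (keep _ _ (sub_ae _ _ axy)).
  by rewrite pa axy.
apply/detP => psi pa keep.
have apsi : automorphism e psi by move=> x y; rewrite !aE !pa.
apply: whole => // [|x y].
  have [[]//|[pu pv]] := aut_ends apsi.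
  have := a_or u v uv_edge; rewrite -(pa u v) pu pv.
  by case: (a v u).
rewrite /arc_view aE pa; case axy: (a x y) => //=; first by rewrite keep.
by move=> ayx; rewrite keep.
Qed.

(** * The branch as a rooted tree *)

Lemma branch_in (p : branch) : sval p \in C.
Proof. by rewrite inE; apply: (svalP p). Qed.

Lemma branch_elem x : x \in C -> exists p : branch, sval p = x.
Proof. by rewrite inE => ux; exists (exist _ x ux). Qed.

Lemma branch_relE (p q : branch) : branch_rel p q = e (sval p) (sval q).
Proof.
rewrite /component_rel /del_edge; case: eqP => [E|_]; last by rewrite andbT.
have : v \in [set sval p; sval q] by rewrite E set22.
by rewrite !inE => /orP[]/eqP vE; have := v_out;
  rewrite [X in X \notin _]vE branch_in.
Qed.

Lemma branch_edge_sval (p q : branch) :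
  branch_edge (sval p) (sval q) = branch_rel p q.
Proof. by rewrite /branch_edge !branch_in branch_relE. Qed.

Lemma restrict_aut psi : automorphism e psi -> psi u = u ->
  exists phi : {perm branch}, rooted_automorphism branch_rel branch_root phi
    /\ forall p, sval (phi p) = psi (sval p).
Proof.
move=> apsi pu.
have inb (p : branch) : connect (del_edge e u v) u (psi (sval p)).
  by have := branch_in p; rewrite -(mem_fix _ apsi pu) inE.
pose h (p : branch) : branch := exist _ (psi (sval p)) (inb p).
have hinj : injective h.
  by move=> p q /(congr1 sval)/= /perm_inj; apply: val_inj.
exists (perm hinj); split=> [|p]; last by rewrite permE.
split=> [p q|]; first by rewrite !permE !branch_relE /= apsi.
by apply: val_inj; rewrite permE.
Qed.

Lemma extend_aut (phi : {perm branch}) :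
  rooted_automorphism branch_rel branch_root phi ->
  exists psi, [/\ automorphism e psi, psi u = u
    & forall p, psi (sval p) = sval (phi p)].
Proof.
move=> [aphi phir].
pose h x := if insub x is Some p then sval (phi p) else x.
have hE (p : branch) : h (sval p) = sval (phi p).
  by rewrite /h (valK p).
have hu : h u = u by rewrite -[X in h X]/(sval branch_root) hE phir.
have [||||||psi [apsi eC _]] :=
    glue_aut (f := h) (g := id) Ttree uv_edge uv_edge hu (erefl v).
- by move=> z /branch_elem[p <-]; rewrite hE branch_in.
- by move=> z; rewrite in_setC.
- move=> z w /branch_elem[p <-] /branch_elem[q <-]; rewrite !hE.
  by move/val_inj/perm_inj => ->.
- by [].
- move=> z w /branch_elem[p <-] /branch_elem[q <-].
  by rewrite !hE -!branch_relE aphi.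
- by [].
by exists psi; split=> [||p]; rewrite ?eC ?branch_in.
Qed.

Definition pull k (c : edge_colouring branch k) x y :=
  c [set p : branch | sval p \in [set x; y]].

Lemma pullE k (c : edge_colouring branch k) (p q : branch) :
  pull c (sval p) (sval q) = c [set p; q].
Proof.
by congr c; apply/setP => p'; rewrite !inE -!(inj_eq val_inj).
Qed.

Lemma branch_edge_elem x y : branch_edge x y ->
  exists p q : branch, [/\ sval p = x, sval q = y & branch_rel p q].
Proof.
move=> bxy; have /and3P[/branch_elem[p px] /branch_elem[q qy] _] := bxy.
by exists p, q; split=> //; rewrite -branch_edge_sval px qy.
Qed.

Lemma rigid_pull k (c : edge_colouring branch k) :
  rooted_distinguishing branch_rel branch_root c <-> rigid (pull c).
Proof.
have detP := detectingP (rooted_automorphism branch_rel branch_root)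
  branch_rel (fun p q => c [set p; q]).
split=> [/detP dist psi apsi pu keep x /branch_elem[p <-]|rig].
  have [phi [aphi phiE]] := restrict_aut apsi pu.
  rewrite -phiE (dist phi) ?perm1 // => a b ab.
  by rewrite -!pullE !phiE keep // branch_edge_sval.
apply/detP => phi /extend_aut[psi [apsi pu psiE]] keep.
apply/permP => p; apply: val_inj; rewrite perm1 -[LHS]psiE rig ?branch_in //.
move=> x y /branch_edge_elem[a [b [<- <- ab]]].
by rewrite !psiE !pullE keep.
Qed.

Lemma isomorphic_pull k (c1 c2 : edge_colouring branch k) :
  isomorphic_colourings branch_rel branch_root c1 c2 <->
  isomorphic (pull c1) (pull c2).
Proof.
split=> [[phi /extend_aut[psi [apsi pu psiE]] c12]|[psi [apsi pu c12]]].
  exists psi; split=> // x y /branch_edge_elem[a [b [<- <- ab]]].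
  by rewrite !psiE !pullE c12.
have [phi [aphi phiE]] := restrict_aut apsi pu.
exists phi => // a b ab; rewrite -!pullE !phiE c12 //.
by rewrite branch_edge_sval.
Qed.

(** Hence the index of T' can be bounded by giving a symmetric function on pairs
    of vertices of T instead of a colouring of T'. *)
Lemma pull_onto k (f : V -> V -> 'I_k) :
  (forall x y, branch_edge x y -> f y x = f x y) ->
  exists c : edge_colouring branch k,
    forall x y, branch_edge x y -> pull c x y = f x y.
Proof.
move=> fC; pose ends (A : {set branch}) (pq : branch * branch) :=
  branch_rel pq.1 pq.2 && (A == [set pq.1; pq.2]).
pose c (A : {set branch}) : 'I_k :=
  if [pick pq | ends A pq] is Some pq then f (sval pq.1) (sval pq.2) else f u u.
exists c => x y /branch_edge_elem[p [q [<- <- pq]]].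
rewrite pullE /c; case: pickP => [[p' q'] /andP[/= pq' /eqP]|/(_ (p, q))].
  move/set2_inj => [[-> ->]//|[-> ->]].
  by rewrite -fC // branch_edge_sval.
by rewrite /ends /= pq eqxx.
Qed.

Lemma rooted_index_le q k (f : V -> V -> 'I_k) :
  rooted_dist_index branch_rel branch_root q -> 0 < k ->
  (forall x y, branch_edge x y -> f y x = f x y) -> rigid f -> q <= k.
Proof.
move=> [_ least] k_gt0 fC rf; have [c cE] := pull_onto fC.
apply: least; split=> //; exists c; apply/rigid_pull.
by apply: eq_rigid rf => x y /cE.
Qed.

(** When all edges have different colours, a colour-preserving automorphism
    fixing the root fixes every vertex, by induction along paths from it. *)
Lemma rooted_index_ex : exists q, rooted_dist_index branch_rel branch_root q.
Proof.
pose f x y : 'I_#|{set V}| := enum_rank [set x; y].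
have rf : rigid f.
  move=> psi apsi pu keep.
  have step x y : branch_edge x y -> psi x = x -> psi y = y.
    move=> bxy px; have /enum_rank_inj/set2_inj := keep x y bxy.
    by rewrite px => -[[_ ->]|[<- ->]].
  move=> x; rewrite inE => /connectP[p ep ->] {x}.
  elim/last_ind: p ep => [|p y IHp] //; rewrite last_rcons rcons_path.
  case/andP=> ep ey; apply: step (IHp ep); rewrite /branch_edge.
  have uw : connect (del_edge e u v) u (last u p) by apply/connectP; exists p.
  case/andP: (ey) => -> _; rewrite !inE uw andbT /=.
  exact: connect_trans uw (connect1 ey).
have [|c cE] := @pull_onto _ f.
  by move=> x y _; rewrite /f setUC.
apply: (@ex_least _ #|{set V}|); split; last first.
  by exists c; apply/rigid_pull; apply: eq_rigid rf => x y /cE.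
by apply/card_gt0P; exists set0.
Qed.

(** The second colouring is carried to the branch at v along s. *)
Lemma colour_branches k (c1 c2 : edge_colouring branch k) :
  exists c : edge_colouring V k, forall x y, branch_edge x y ->
    c [set x; y] = pull c1 x y /\ c [set s x; s y] = pull c2 x y.
Proof.
exists (fun A : {set V} => if A \subset C then c1 [set p : branch | sval p \in A]
                 else c2 [set p : branch | s (sval p) \in A]).
move=> x y /and3P[xC yC _].
rewrite !subUset !sub1set xC yC !(mem_swap _ s_aut s_u) xC /=.
by split=> //; congr c2; apply/setP => p; rewrite !inE !(inj_eq perm_inj).
Qed.

(** * The indices of orientations *)

Lemma arc_view_flip k a (c : arc_colouring V k) x y :
  orientation e a -> e x y ->
  arc_view a c y x = (~~ (arc_view a c x y).1, (arc_view a c x y).2).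
Proof.
move=> [_ a_or] exy; rewrite /arc_view; have := a_or x y exy.
by case: (a x y); case: (a y x).
Qed.

Lemma orientation_away : orientation e (away e u).
Proof.
by split=> [x y /andP[]|x y exy] //; apply: away_orients.
Qed.

Lemma not_away x y : branch_edge x y -> away e u y x = ~~ away e u x y.
Proof.
move=> /and3P[_ _ exy]; have := away_orients Ttree u exy.
by case: (away e u x y) => /= [/negPf|].
Qed.

(** Reading each edge of the branch away from u turns the pairs (direction,
    colour) into a colouring of T' by 2k colours. *)
Lemma uphalf_index_le a q k (c : arc_colouring V k) :
  rooted_dist_index branch_rel branch_root q -> orientation e a -> 0 < k ->
  arc_distinguishing a c -> uphalf q <= k.
Proof.
move=> qP a_or k_gt0 /(arc_distinguishing_halves _ a_or)[rig _].
pose f x y : 'I_#|{: bool * 'I_k}| :=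
  enum_rank (if away e u x y then arc_view a c x y else arc_view a c y x).
have fC x y : branch_edge x y -> f y x = f x y.
  by move=> bxy; rewrite /f not_away //; case: (away e u x y).
have card2k : #|{: bool * 'I_k}| = k.*2.
  by rewrite card_prod card_bool card_ord mul2n.
rewrite leq_uphalf_double -card2k; apply: (rooted_index_le qP) fC _.
  by rewrite card2k double_gt0.
apply: rigid_sub rig => psi apsi pu keep x y bxy.
have /and3P[_ _ exy] := bxy; have := keep x y bxy.
rewrite /f (away_aut x y apsi pu); case: (away e u x y) => /enum_rank_inj.
  by [].
have flip := @arc_view_flip _ a c _ _ a_or.
by move=> keep_yx; rewrite flip ?[RHS]flip ?keep_yx ?apsi // symE.
Qed.

(** Automorphisms fixing u preserve the direction away from u, so that only the
    k colours are left to break them. *)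
Lemma away_index_le q k (c : arc_colouring V k) :
  rooted_dist_index branch_rel branch_root q -> 0 < k ->
  arc_distinguishing (away e u) c -> q <= k.
Proof.
move=> qP k_gt0 /(arc_distinguishing_halves _ orientation_away)[rig _].
pose f x y := if away e u x y then c x y else c y x.
have fC x y : branch_edge x y -> f y x = f x y.
  by move=> bxy; rewrite /f not_away //; case: (away e u x y).
apply: (rooted_index_le qP) fC _ => //.
apply: rigid_sub rig => psi apsi pu keep x y bxy.
have := keep x y bxy; rewrite /f /arc_view.
by rewrite !(away_aut _ _ apsi pu) => ->.
Qed.

Lemma orientation_colouring a q :
  rooted_dist_index branch_rel branch_root q -> orientation e a ->
  exists c : arc_colouring V q, arc_distinguishing a c.
Proof.
move=> [[q_gt0 [c0 /rigid_pull rig]] _] a_or.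
have [c cE] := colour_branches c0 c0; exists (fun x y => c [set x; y]).
have viewE x y : (arc_view a (fun x y => c [set x; y]) x y).2 = c [set x; y].
  by rewrite /arc_view /= setUC if_same setUC.
apply/(arc_distinguishing_halves _ a_or); split.
  apply: rigid_sub rig => psi apsi pu keep x y bxy.
  by rewrite -!(cE _ _ _).1 ?branch_edge_fix // -!viewE keep.
apply: rigid_sub rig => psi apsi pu keep x y bxy.
by rewrite -!(cE _ _ _).2 ?branch_edge_fix // -!viewE [arc_view _ _ _ _]keep.
Qed.

(** The parity of an optimal colour is stored as a direction relative to the one
    away from u, and its half as the colour of the arc. Automorphisms fixing u
    respect the reference direction, so a pair preserved by them determines the
    parity, and the optimal colour is recovered. *)
Lemma half_orientation q :
  rooted_dist_index branch_rel branch_root q ->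
  exists2 a, orientation e a &
    exists c : arc_colouring V (uphalf q), arc_distinguishing a c.
Proof.
move=> [[q_gt0 [c0 /rigid_pull rig]] _].
have [c cE] := colour_branches c0 c0; pose g x y := c [set x; y].
have gC x y : g y x = g x y by rewrite /g setUC.
have half_lt (i : 'I_q) : i./2 < uphalf q.
  by rewrite -[_ < _]/(uphalf i.+1 <= _) uphalf_leq.
pose a x y := e x y && (away e u x y (+) odd (g x y)).
have a_or : orientation e a.
  split=> [x y /andP[]//|x y exy]; have := away_orients Ttree u exy.
  rewrite /a exy symE exy gC /=.
  by case: (away e u x y); case: (away e u y x); case: (odd _).
exists a => //; pose h x y := Ordinal (half_lt (g x y)); exists h.
have viewE x y : (arc_view a h x y).2 = h x y.
  by rewrite /arc_view /= {2}/h gC if_same.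
have decode psi : automorphism e psi -> psi u = u -> forall x y, e x y ->
    arc_view a h (psi x) (psi y) = arc_view a h x y ->
    g (psi x) (psi y) = g x y.
  move=> apsi pu x y exy E; apply: val_inj.
  have := congr1 snd E; rewrite !viewE => /(congr1 val)/= halfE.
  have := congr1 fst E; rewrite /= /a apsi exy (away_aut _ _ apsi pu) /=.
  move/addbI => oddE.
  by rewrite -[LHS]odd_double_half -[RHS]odd_double_half halfE oddE.
apply/(arc_distinguishing_halves _ a_or); split.
  apply: rigid_sub rig => psi apsi pu keep x y bxy.
  rewrite -!(cE _ _ _).1 ?branch_edge_fix //; apply: decode; rewrite ?keep //.
  by case/and3P: bxy.
apply: rigid_sub rig => psi apsi pu keep x y bxy.
rewrite -!(cE _ _ _).2 ?branch_edge_fix //.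
have Js z : (psi ^ s)%g (s z) = s (psi z) by rewrite permJ.
rewrite -!Js; apply: decode; first exact: automorphismJ.
- by rewrite -{1}s_v permJ (aut_fix_v apsi pu).
- by rewrite s_aut; case/and3P: bxy.
by rewrite !Js [LHS]keep.
Qed.

Lemma arc_index_bounds a q :
  rooted_dist_index branch_rel branch_root q -> orientation e a ->
  exists2 k, arc_dist_index a k & uphalf q <= k <= q.
Proof.
move=> qP a_or; have [[q_gt0 _] _] := qP.
have [c cP] := orientation_colouring qP a_or.
have [|k kP] := @ex_least (fun k => 0 < k /\
  exists c : arc_colouring V k, arc_distinguishing a c) q.
  by split=> //; exists c.
exists k => //; have [[k_gt0 [c' c'P]] least] := kP.
rewrite (uphalf_index_le qP a_or k_gt0 c'P) least //.
by split=> //; exists c.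
Qed.

Lemma OD_max_rooted q :
  rooted_dist_index branch_rel branch_root q -> OD_max e q.
Proof.
move=> qP; split=> [|a a_or].
  have [k kP /andP[_ le_kq]] := arc_index_bounds qP orientation_away.
  exists (away e u); first exact: orientation_away.
  suff -> : q = k by [].
  have [[k_gt0 [c cP]] _] := kP; apply/eqP; rewrite eqn_leq le_kq andbT.
  exact: away_index_le cP.
by have [k kP /andP[]] := arc_index_bounds qP a_or; exists k.
Qed.

Lemma OD_min_rooted q :
  rooted_dist_index branch_rel branch_root q -> OD_min e (uphalf q).
Proof.
move=> qP; split=> [|a a_or].
  have [a a_or [c cP]] := half_orientation qP; exists a => //.
  have [k kP /andP[le_qk _]] := arc_index_bounds qP a_or.
  suff -> : uphalf q = k by [].
  apply/eqP; rewrite eqn_leq le_qk; apply: kP.2; split; last by exists c.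
  by have [[]] := qP; case: (q).
by have [k kP /andP[]] := arc_index_bounds qP a_or; exists k.
Qed.

(** * The distinguishing index of the tree *)

Lemma branch_colourings k (c : edge_colouring V k) : distinguishing e c ->
  exists c1 c2 : edge_colouring branch k,
    [/\ rooted_distinguishing branch_rel branch_root c1,
        rooted_distinguishing branch_rel branch_root c2
      & ~ isomorphic_colourings branch_rel branch_root c1 c2].
Proof.
move/distinguishing_halves => [r1 r2 niso]; set f := fun x y => _ in r1 r2 niso.
have [|c1 c1E] := @pull_onto _ f; first by move=> x y _; rewrite /f setUC.
have [|c2 c2E] := @pull_onto _ (through_s f).
  by move=> x y _; rewrite /through_s /f setUC.
exists c1, c2; split.
- by apply/rigid_pull; apply: eq_rigid r1 => x y /c1E.
- by apply/rigid_pull; apply: eq_rigid r2 => x y /c2E.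
by move/isomorphic_pull; apply: contra_not niso; apply: eq_isomorphic.
Qed.

Lemma join_branch_colourings k (c1 c2 : edge_colouring branch k) :
  rooted_distinguishing branch_rel branch_root c1 ->
  rooted_distinguishing branch_rel branch_root c2 ->
  ~ isomorphic_colourings branch_rel branch_root c1 c2 ->
  exists c : edge_colouring V k, distinguishing e c.
Proof.
move=> /rigid_pull r1 /rigid_pull r2 niso; have [c cE] := colour_branches c1 c2.
exists c; apply/distinguishing_halves; split.
- by apply: eq_rigid r1 => x y /cE[].
- by apply: eq_rigid r2 => x y /cE[].
move=> iso; apply: niso; apply/isomorphic_pull.
by apply: eq_isomorphic iso => x y /cE[].
Qed.

Lemma branch_has_edge : 2 < #|V| -> exists x y, branch_edge x y.
Proof.
move=> V3; have [z zC zu] : exists2 z, z \in C & z != u.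
  have : ~~ ([set: V] \subset [set u; v]).
    apply: contraL V3 => /subset_leq_card.
    by rewrite cardsT cards2 neq_uv -leqNgt.
  case/subsetPn=> z _; rewrite !inE negb_or => /andP[zu zv].
  case: (boolP (z \in C)) => zC; first by exists z.
  exists (s z); first by rewrite (mem_swap _ s_aut s_u).
  by rewrite -s_v (inj_eq perm_inj).
move: zC; rewrite inE => /connectP[[|w p] /= ep zE]; first by rewrite zE eqxx in zu.
case/andP: ep => uw _; exists u, w; rewrite /branch_edge u_in inE connect1 //=.
by case/andP: uw.
Qed.

(** Relabelling a distinguishing colouring injectively into k + 1 colours keeps
    it distinguishing, and any colour may be left out. The colour j that the first
    relabelling gives to the edge xy is the one left out by the second. *)
Lemma extra_colour k : 2 < #|V| -> forall c : edge_colouring branch k,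
  rooted_distinguishing branch_rel branch_root c ->
  exists c' : edge_colouring V k.+1, distinguishing e c'.
Proof.
move=> /branch_has_edge[x [y bxy]] c cP; pose i := pull c x y.
pose j := lift ord_max i.
have lifted (h : 'I_k.+1) :
    rooted_distinguishing branch_rel branch_root (fun A => lift h (c A)).
  apply/rigid_pull; move/rigid_pull: cP; apply: rigid_sub => psi _ _ keep z w b.
  exact: lift_inj (keep z w b).
apply: join_branch_colourings (lifted ord_max) (lifted j) _.
move=> /isomorphic_pull/isomorphic_sym[psi [_ _ /(_ x y bxy)]] /eqP.
by rewrite -[X in X == _]/j (negPf (neq_lift _ _)).
Qed.

End Bicentral.

Theorem theorem9 (V : finType) (e : rel V) (u v : V)
    (Ttree : tree e) (Torder : 3 <= #|V|)
    (uv_edge : e u v) (uv_centre : centre e = [set u; v])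
    (uv_swap : exists phi : {perm V},
       [/\ automorphism e phi, phi u = v & phi v = u]) :
  let T' := component_rel (del_edge e u v) u in
  let r := component_root (del_edge e u v) u in
  exists2 d, dist_index e d &
    (two_optimal_colourings T' r -> OD_max e d /\ OD_min e (uphalf d)) /\
    (unique_optimal_colouring T' r ->
       OD_max e (d - 1) /\ OD_min e (uphalf (d - 1))).
Proof.
move=> T' r; have [s [s_aut s_u s_v]] := uv_swap.
have [q qP] := rooted_index_ex Ttree uv_edge uv_centre.
have [[q_gt0 [c0 c0P]] least] := qP.
(* These values serve both cases: the index d below is q in case (i), and
   q + 1 in case (ii). *)
have OD : OD_max e q /\ OD_min e (uphalf q).
  split; first exact: (OD_max_rooted Ttree uv_edge uv_centre s_aut s_u s_v).
  exact: (OD_min_rooted Ttree uv_edge uv_centre s_aut s_u s_v).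
have restr := branch_colourings Ttree uv_edge uv_centre s_aut s_u s_v.
have le_q k : 0 < k -> (exists c : edge_colouring V k, distinguishing e c) -> q <= k.
  move=> k_gt0 [c /restr[c1 [c2 [c1P _ _]]]]; apply: least; split=> //.
  by exists c1.
have index_q q' : rooted_dist_index T' r q' -> q' = q.
  by move/is_least_uniq; apply.
have [two|one] := classic (exists c1 c2 : edge_colouring (component _ u) q,
  [/\ rooted_distinguishing T' r c1, rooted_distinguishing T' r c2
    & ~ isomorphic_colourings T' r c1 c2]).
  have [c1 [c2 [c1P c2P niso]]] := two; exists q.
    split=> [|k [k_gt0]]; last exact: le_q.
    split=> //.
    exact: (join_branch_colourings Ttree uv_edge uv_centre s_aut s_u s_v c1P c2P).
  split=> // -[q' [c [[q'P _] uniq]]]; have qE := index_q _ q'P.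
  rewrite {q'}qE in c q'P uniq *.
  have iso c' : rooted_distinguishing T' r c' -> isomorphic e u v (pull c) (pull c').
    move=> c'P; apply/(isomorphic_pull Ttree uv_edge uv_centre).
    exact: uniq.
  case: niso; apply/(isomorphic_pull Ttree uv_edge uv_centre).
  apply: isomorphic_trans (iso _ c2P) => //.
  by apply: isomorphic_sym => //; apply: iso.
exists q.+1.
  split=> [|k [k_gt0 kP]].
    split=> //.
    exact: (extra_colour Ttree uv_edge uv_centre s_aut s_u s_v Torder c0P).
  rewrite ltn_neqAle le_q // andbT; apply: contra_not_neq one => qE.
  by move: kP; rewrite -qE => -[c /restr].
rewrite subn1 /=; split=> // -[q' [c1 [c2 [[q'P c1P] [_ c2P] niso]]]].
have qE := index_q _ q'P; rewrite {q'}qE in c1 c2 c1P c2P niso q'P.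
by case: one; exists c1, c2.
Qed.
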